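(* Let $k\ge 2$ and let $f^k_{k,n}$ and $l^k_{k,n}$ be the $k$-th sequences of the $k$ sequences of generalized order-$k$ Fibonacci numbers and Lucas numbers, respectively, as defined in the context. Then for every integer $n\ge 0$, $$l^k_{k,n}=\sum_{j=1}^{k} j\, f^k_{k,n+1-j}.$$
   Context: $k$ sequences of generalized order-$k$ Fibonacci numbers: for $1\le i\le k$, $f^i_{k,n}=1$ if $1-k\le n\le 0$ and $i=1-n$, $f^i_{k,n}=0$ if $1-k\le n\le 0$ and $i\neq 1-n$, and $f^i_{k,n}=\sum_{j=1}^k f^i_{k,n-j}$ for $n\ge 1$. $k$ sequences of generalized order-$k$ Lucas numbers: for $1\le i\le k$ and $1-k\le n\le 0$, $l^i_{k,n}=-i$ if $i-n<k$, $l^i_{k,n}=i-2n$ if $i-n=k$, $l^i_{k,n}=k-i-1$ if $i-n>k$; and $l^i_{k,n}=\sum_{j=1}^k l^i_{k,n-j}$ for $n\ge 1$. *)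

(* Defs.v *)
From mathcomp Require Import all_boot all_order all_algebra.

Set Implicit Arguments.
Unset Strict Implicit.
Unset Printing Implicit Defensive.

Import Order.TTheory GRing.Theory Num.Theory.
Local Open Scope ring_scope.

(* [:: u_m; u_(m-1); ...; u_0; ...; u_(1-k)] for the order-k sequence u with
   u_n = init n for 1 - k <= n <= 0 and u_n = u_(n-1) + ... + u_(n-k) for
   n >= 1. *)
Fixpoint order_hist (k : nat) (init : int -> int) (m : nat) : seq int :=
  if m is m'.+1 then
    (\sum_(j < k) (order_hist k init m')`_j) :: order_hist k init m'
  else [seq init (- j%:Z) | j <- iota 0 k].

(* The values at n < 1 - k are irrelevant: the sequences start at 1 - k. *)
Definition order_seq (k : nat) (init : int -> int) (n : int) : int :=
  if n is Posz m.+1 then (order_hist k init m.+1)`_0 else init n.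

Definition gfib_init (i : nat) (n : int) : int :=
  if i%:Z == 1 - n then 1 else 0.

Definition glucas_init (k i : nat) (n : int) : int :=
  if i%:Z - n < k%:Z then - i%:Z
  else if i%:Z - n == k%:Z then i%:Z - 2 * n
  else k%:Z - i%:Z - 1.

(* gfib k i n is f^i_{k,n} and glucas k i n is l^i_{k,n}, for 1 <= i <= k. *)
Definition gfib (k i : nat) : int -> int := order_seq k (gfib_init i).
Definition glucas (k i : nat) : int -> int := order_seq k (glucas_init k i).

Lemma order_seq_init (k : nat) (init : int -> int) (n : int) :
  n <= 0 -> order_seq k init n = init n.
Proof. by case: n => [[|m]|m]. Qed.

Lemma nth_order_hist (k : nat) (init : int -> int) (m j : nat) :
  (j < m + k)%N -> (order_hist k init m)`_j = order_seq k init (m%:Z - j%:Z).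
Proof.
elim: m j => [|m IHm] j ltj.
  rewrite sub0r order_seq_init ?oppr_le0 //= (nth_map 0%N) ?size_iota //.
  by rewrite nth_iota.
case: j ltj => [|j] ltj; first by rewrite subr0.
by rewrite /= IHm // !intS opprD addrACA subrr add0r.
Qed.

Lemma order_seq_rec (k : nat) (init : int -> int) (n : int) :
  1 <= n ->
  order_seq k init n = \sum_(1 <= j < k.+1) order_seq k init (n - j%:Z).
Proof.
case: n => [[|m]|m] // _.
rewrite big_add1 big_mkord; apply: eq_bigr => j _.
rewrite nth_order_hist ?(leq_trans (ltn_ord j)) ?leq_addl //.
by rewrite !intS opprD addrACA subrr add0r.
Qed.

(* Main.v *)
Require Import Defs.
From mathcomp Require Import all_boot all_order all_algebra.
From mathcomp Require Import zify.

Import Order.TTheory GRing.Theory Num.Theory.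
Local Open Scope ring_scope.

(** Continue f^k backwards beyond index 1-k by the value -1 at -k and 0 further
    below: the recurrence then holds at every index m >= 2-k. Hence
    sum_j j f_{n+1-j}, a combination of shifts of this sequence, satisfies the
    recurrence for all n >= 1, and on 1-k <= n <= 0 it takes the values k at 0
    and -1 elsewhere, which are the initial values of l^k. For n >= 0 the
    added value at -k does not enter the sum. *)

(** Strong induction on [|n|]: for [n >= 1] each [n - j] is either in the initial window or positive
    and smaller than [n]. *)
Lemma order_seq_unique (k : nat) (init u : int -> int) :
  (forall n : int, 1 - k%:Z <= n <= 0 -> u n = init n) ->
  (forall n : int, 1 <= n -> u n = \sum_(1 <= j < k.+1) u (n - j%:Z)) ->
  forall n : int, 1 - k%:Z <= n -> order_seq k init n = u n.
Proof.
move=> u_init u_rec n; have [N] := ubnP `|n|%N.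
elim: N n => // N IHN n ltnN len.
have [n_le0 | n_gt0] := leP n 0.
  by rewrite order_seq_init // u_init // len.
have n_ge1 : 1 <= n by lia.
rewrite order_seq_rec // u_rec //; apply: eq_big_nat => j /andP[j_ge1 j_lek].
have [d_le0 | d_gt0] := leP (n - j%:Z) 0; last by apply: IHN; lia.
by rewrite order_seq_init // u_init //; lia.
Qed.

(** [gfib k k] is already 0 below [1 - k], so only the value at [-k] is corrected. *)
Definition gfib_ext (k : nat) (m : int) : int :=
  gfib k k m - (m == - k%:Z)%:R.

Lemma gfib_extE (k : nat) (m : int) : - k%:Z < m -> gfib_ext k m = gfib k k m.
Proof. by move=> ltm; rewrite /gfib_ext gt_eqF // subr0. Qed.

Lemma gfib_ext_le0 (k : nat) (m : int) :
  m <= 0 -> gfib_ext k m = (m == 1 - k%:Z)%:R - (m == - k%:Z)%:R.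
Proof.
move=> m_le0; rewrite /gfib_ext /gfib order_seq_init // /gfib_init.
have -> : (k%:Z == 1 - m) = (m == 1 - k%:Z) by lia.
by case: (m == _).
Qed.

(** The two nonzero values are met at [j = k - p] and [j = k + 1 - p]; the latter leaves the range
    when [p = 0]. Weights 1 serve the recurrence, weights [j] the initial values. *)
Lemma sum_gfib_ext (k : nat) (c : nat -> int) (p : nat) : (p < k)%N ->
  \sum_(1 <= j < k.+1) c j * gfib_ext k (1 - p%:Z - j%:Z) =
  c (k - p)%N - (if p == 0%N then 0 else c (k.+1 - p)%N).
Proof.
move=> ltpk.
transitivity (\sum_(1 <= j < k.+1 | j == (k - p)%N) c j -
              \sum_(1 <= j < k.+1 | j == (k.+1 - p)%N) c j).
  rewrite !(big_mkcond (fun j => j == _)) -sumrB.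
  apply: eq_big_nat => j /andP[j_ge1 j_lek].
  rewrite gfib_ext_le0; last by lia.
  have -> : (1 - p%:Z - j%:Z == 1 - k%:Z) = (j == (k - p)%N) by lia.
  have -> : (1 - p%:Z - j%:Z == - k%:Z) = (j == (k.+1 - p)%N) by lia.
  by rewrite mulrBr; do 2!case: (j == _); rewrite ?mulr1 ?mulr0.
rewrite !big_nat1_eq.
have -> : (1 <= k - p < k.+1)%N by lia.
have -> : (1 <= k.+1 - p < k.+1)%N = (p != 0%N) by lia.
by case: (p == 0%N).
Qed.

Lemma gfib_ext_rec (k : nat) (m : int) : 2 - k%:Z <= m ->
  gfib_ext k m = \sum_(1 <= j < k.+1) gfib_ext k (m - j%:Z).
Proof.
move=> lem; have [m_le0 | m_gt0] := leP m 0.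
  have [p m_eq] : exists p : nat, m = - p%:Z by exists `|m|%N; lia.
  (* The shift to [p.+1] makes the indices [m - j]; as it is nonzero, both values occur and
     cancel. *)
  have /(@sum_gfib_ext _ (fun=> 1)) : (p.+1 < k)%N by lia.
  rewrite subrr gfib_ext_le0 // => sum0.
  have [-> ->] : (m == 1 - k%:Z) = false /\ (m == - k%:Z) = false by lia.
  rewrite subrr -[LHS]sum0; apply: eq_bigr => j _; rewrite mul1r.
  by congr gfib_ext; lia.
rewrite gfib_extE; last by lia.
rewrite /gfib order_seq_rec; last by lia.
by apply: eq_big_nat => j j_bnd; rewrite gfib_extE //; lia.
Qed.

Lemma glucas_gfib_ext (k : nat) (n : int) : 1 - k%:Z <= n ->
  glucas k k n = \sum_(1 <= j < k.+1) j%:Z * gfib_ext k (n + 1 - j%:Z).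
Proof.
apply: (@order_seq_unique k _ (fun m =>
  \sum_(1 <= j < k.+1) j%:Z * gfib_ext k (m + 1 - j%:Z))) => {}n.
  move=> /andP[len n_le0].
  have [p n_eq] : exists p : nat, n = - p%:Z by exists `|n|%N; lia.
  have ltpk : (p < k)%N by lia.
  rewrite n_eq addrC sum_gfib_ext // /glucas_init opprK.
  have -> : (k%:Z + p%:Z < k%:Z) = false by lia.
  have -> : (k%:Z + p%:Z == k%:Z) = (p == 0%N) by lia.
  by case: (eqVneq p 0%N); lia.
move=> n_ge1; rewrite exchange_big /=.
apply: eq_big_nat => j /andP[j_ge1 j_lek].
(* Here [n + 1 - j >= 2 - k], with equality at [n = 1], [j = k]. *)
rewrite gfib_ext_rec; last by lia.
rewrite mulr_sumr; apply: eq_bigr => i _.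
by congr (_ * gfib_ext k _); lia.
Qed.

Theorem theorem2p8 (k : nat) (hk : (2 <= k)%N) (n : int) (hn : 0 <= n) :
  glucas k k n = \sum_(1 <= j < k.+1) j%:Z * gfib k k (n + 1 - j%:Z).
Proof.
rewrite glucas_gfib_ext; last by lia.
by apply: eq_big_nat => j j_bnd; rewrite gfib_extE //; lia.
Qed.
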